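(* Let $A,B\subseteq\mathbb{R}^2$ be nonempty closed convex cones. Then for any initial guess $x\in\mathbb{R}^2$, the circumcentered-reflection method finds a feasible point in $A\cap B$ in at most three steps; that is, for every $x\in\mathbb{R}^2$ there exists $k\in\{0,1,2,3\}$ such that $C_T^k(x)\in A\cap B$, where $C_T(x)=C\big(x,R_A(x),R_B(R_A(x))\big)$ is the circumcentered-reflection operator of $A,B$.
   Context: $\mathbb{R}^2$ carries the Euclidean inner product and norm. A set $S$ is a closed cone if it is closed and $S=\bigcup_{\lambda\ge 0}\lambda S$. For a nonempty closed convex set $C$, $P_C$ is the metric projection onto $C$ and $R_C=2P_C-\mathrm{Id}$ is the reflection operator. The circumcenter $C(x,y,z)$ of three points is the point of the affine hull $\mathrm{aff}\{x,y,z\}$ that is equidistant from $x,y,z$; it exists and is unique when $x,y,z$ are not collinear; if $\{x,y,z\}$ has exactly two distinct elements, $C(x,y,z)$ is their midpoint, and if $x=y=z$ then $C(x,y,z)=x$. The circumcentered-reflection operator is $C_T(x)=C(x,R_A(x),R_B(R_A(x)))$; the circumcentered-reflection method (CRM) iterates $C_T$, and $C_T^k$ denotes the $k$-fold iterate ($C_T^0=\mathrm{Id}$). (For closed convex cones, $x,R_A(x),R_B(R_A(x))$ have the same norm, so $C_T$ is defined everywhere.) *)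

(* Defs.v *)
From HB Require Import structures.
From mathcomp Require Import all_boot all_order all_algebra.
From mathcomp Require Import all_classical all_reals all_analysis.

Set Implicit Arguments.
Unset Strict Implicit.
Unset Printing Implicit Defensive.

Import Order.TTheory GRing.Theory Num.Theory.
Import numFieldNormedType.Exports.

Local Open Scope classical_set_scope.
Local Open Scope ring_scope.

Definition dotv (R : realType) (n : nat) (u v : 'rV[R]_n) : R :=
  \sum_(i < n) u ord0 i * v ord0 i.

(* The norm `|u| that the library puts on 'rV[R]_n is the maximum norm, so the
   Euclidean one is defined here.  Both induce the topology used by [closed]. *)
Definition enorm (R : realType) (n : nat) (u : 'rV[R]_n) : R :=
  Num.sqrt (dotv u u).

Definition closed_cone (R : realType) (n : nat) (S : set 'rV[R]_n) : Prop :=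
  closed S /\
  S = \bigcup_(l in [set l : R | 0 <= l]) [set l *: v | v in S].

Definition closest_point (R : realType) (n : nat) (C : set 'rV[R]_n)
    (x p : 'rV[R]_n) : Prop :=
  C p /\ forall q, C q -> enorm (x - p) <= enorm (x - q).

(* The closest point exists and is unique when C is nonempty, closed and convex;
   the default value x is only taken for other sets C. *)
Definition proj (R : realType) (n : nat) (C : set 'rV[R]_n)
    (x : 'rV[R]_n) : 'rV[R]_n :=
  xget x [set p | closest_point C x p].

Definition refl (R : realType) (n : nat) (C : set 'rV[R]_n)
    (x : 'rV[R]_n) : 'rV[R]_n :=
  2 *: proj C x - x.

Definition aff3 (R : realType) (n : nat) (x y z : 'rV[R]_n) : set 'rV[R]_n :=
  [set p | exists a b c : R,
     a + b + c = 1 /\ p = a *: x + b *: y + c *: z].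

Definition is_circumcenter (R : realType) (n : nat)
    (x y z c : 'rV[R]_n) : Prop :=
  [/\ aff3 x y z c,
      enorm (c - x) = enorm (c - y) &
      enorm (c - y) = enorm (c - z)].

(* At most one point satisfies [is_circumcenter x y z].  If x, y, z take two
   distinct values it is their midpoint, and if x = y = z it is x, so these cases
   need no separate clause.  There is none exactly when x, y, z are pairwise distinct and
   collinear, which never happens when they have the same Euclidean norm; only
   then is the default value x taken. *)
Definition circumcenter (R : realType) (n : nat)
    (x y z : 'rV[R]_n) : 'rV[R]_n :=
  xget x [set c | is_circumcenter x y z c].

Definition CRM (R : realType) (n : nat) (A B : set 'rV[R]_n)
    (x : 'rV[R]_n) : 'rV[R]_n :=
  circumcenter x (refl A x) (refl B (refl A x)).

(* Main.v *)
Require Import Defs.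
From mathcomp Require Import all_boot all_order all_algebra.
From mathcomp Require Import all_classical all_reals all_analysis.
From mathcomp Require Import ring lra.

(** A projection onto a closed cone is orthogonal to its error, so reflections
in cones preserve the norm: [x], [y := R_A x] and [w := R_B y] lie on a circle
centred at the origin. In the plane, three distinct points of such a circle
have circumcenter [0], which belongs to both cones ([circumcenter_circle]).
When two of the three points coincide, the circumcenter is a midpoint, and the
midpoint of a point and its reflection is the projection of that point
([midpoint_refl]). This leaves the following cases for one step.

- If [x] is in [A], then [y = x] and the step is [P_B x] ([CRM_proj]).
- If [x] is not in [A], the step is [P_A x] or [0], so it lands in [A]. It
  moreover lands in [B] when [x] was already in [B] ([CRM_outside]): either
  [w = y], so [y] is in [B] and [P_A x] is the midpoint of the two points [x]
  and [y] of the convex set [B]; or [w = x], and [P_A x] is the midpoint of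
  [y] and [R_B y], that is [P_B y]; or the step is [0].

Hence a step from any point lands in [A] or in [B], a step from [A] lands in
[B], and a step from [B] lands in the intersection of [A] and [B]. Following
these three kinds of steps takes at most three iterations. *)

Set Implicit Arguments.
Unset Strict Implicit.
Unset Printing Implicit Defensive.

Import Order.TTheory GRing.Theory Num.Theory.
Import numFieldNormedType.Exports.
Local Open Scope classical_set_scope.
Local Open Scope ring_scope.

(* Unqualified, [proj] would denote a coordinate map of a product space. *)
Local Notation proj := Defs.proj.

(** * The Euclidean inner product and its topology *)

Section InnerProduct.
Context {R : realType} {n : nat}.
Implicit Types (u v w : 'rV[R]_n) (a : R).

Lemma dotvC u v : dotv u v = dotv v u.
Proof. by apply: eq_bigr => i _; rewrite mulrC. Qed.

Lemma dotvDl u v w : dotv (u + v) w = dotv u w + dotv v w.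
Proof. by rewrite /dotv -big_split; apply: eq_bigr => i _; rewrite mxE mulrDl. Qed.

Lemma dotvZl a u w : dotv (a *: u) w = a * dotv u w.
Proof. by rewrite /dotv mulr_sumr; apply: eq_bigr => i _; rewrite mxE mulrA. Qed.

Lemma dotvNl u w : dotv (- u) w = - dotv u w.
Proof. by rewrite -scaleN1r dotvZl mulN1r. Qed.

Lemma dotvDr u v w : dotv w (u + v) = dotv w u + dotv w v.
Proof. by rewrite dotvC dotvDl !(dotvC w). Qed.

Lemma dotvZr a u w : dotv w (a *: u) = a * dotv w u.
Proof. by rewrite dotvC dotvZl (dotvC w). Qed.

Lemma dotvNr u w : dotv w (- u) = - dotv w u.
Proof. by rewrite dotvC dotvNl (dotvC w). Qed.

Lemma dotv0r w : dotv w 0 = 0.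
Proof. by rewrite -(scale0r (0 : 'rV[R]_n)) dotvZr mul0r. Qed.

Definition dotvE := (dotvDl, dotvDr, dotvNl, dotvNr, dotvZl, dotvZr).

Lemma dotv_ge0 u : 0 <= dotv u u.
Proof. by apply: sumr_ge0 => i _; rewrite -expr2 sqr_ge0. Qed.

Lemma dotv_eq0 u : dotv u u = 0 -> u = 0.
Proof.
move=> /eqP; rewrite psumr_eq0 => [/allP u0|i _]; last by rewrite -expr2 sqr_ge0.
apply/rowP => i; rewrite mxE.
have := u0 i (mem_index_enum i).
by rewrite /= -expr2 sqrf_eq0 => /eqP.
Qed.

Lemma enorm_le u v : (enorm u <= enorm v) = (dotv u u <= dotv v v).
Proof. by rewrite ler_sqrt// dotv_ge0. Qed.

Lemma enorm_eq u v : enorm u = enorm v <-> dotv u u = dotv v v.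
Proof.
split=> [uv|uv]; last by rewrite /enorm uv.
by apply/eqP; rewrite eq_le -!enorm_le uv lexx.
Qed.

(** Boundedness of sets of vectors is expressed with the maximum norm; this
transfers Euclidean bounds to it. *)
Lemma mx_norm_le_enorm u : `|u| <= enorm u.
Proof.
rewrite [`|u|]mx_normrE; apply: bigmax_le => [|[i j] _] /=; first exact: sqrtr_ge0.
rewrite (ord1 i) -sqrtr_sqr ler_sqrt ?sqr_ge0 ?dotv_ge0//.
rewrite /dotv (bigD1 j)//= expr2 lerDl.
by apply: sumr_ge0 => k _; rewrite -expr2 sqr_ge0.
Qed.

Lemma cvg_sum_sqr T (F : set_system T) (FF : Filter F) (f : 'I_n -> T -> R)
    (l : 'I_n -> R) :
  (forall i, f i t @[t --> F] --> l i) ->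
  \sum_i f i t * f i t @[t --> F] --> \sum_i l i * l i.
Proof.
move=> fl; elim: (index_enum _) => [|i s IH].
  by rewrite big_nil; under eq_fun do rewrite big_nil; exact: cvg_cst.
rewrite big_cons; under eq_fun do rewrite big_cons.
by apply: cvgD => //; apply: cvgM.
Qed.

Lemma enorm_distC_continuous u : continuous (fun v => enorm (u - v)).
Proof.
have coord_cvg (v : 'rV[R]_n) i : (u - w) ord0 i @[w --> v] --> (u - v) ord0 i.
  rewrite !mxE; under eq_fun do rewrite !mxE.
  by apply: (@cvgB R R^o _ _ (nbhs_filter v));
    [exact: (@cvg_cst R^o _ _ _ (nbhs_filter v))|exact: coord_continuous].
move=> v.
apply: (@continuous_comp _ _ _ (fun w => dotv (u - w) (u - w)) Num.sqrt).
  exact: cvg_sum_sqr (coord_cvg v).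
exact: sqrt_continuous.
Qed.

End InnerProduct.

(** * Nearest points of a closed set *)

Section Projection.
Context {R : realType} {n : nat} {C : set 'rV[R]_n}.
Hypotheses (C0 : C !=set0) (Ccl : closed C).

(** The part of [C] that is at least as close to [x] as some chosen [q0] in [C]
is closed and bounded, hence compact, and the distance to [x] attains its
minimum on it. *)
Lemma closest_point_exists x : exists p, closest_point C x p.
Proof.
have [q0 Cq0] := C0.
pose K := C `&` [set q | enorm (x - q) <= enorm (x - q0)].
have Kcl : closed K.
  apply: closedI => //.
  have := (continuous_closedP _).1 (@enorm_distC_continuous _ _ x).
  by move=> /(_ _ (@closed_le _ (enorm (x - q0)))).
have Kb : bounded_set K.
  exists (`|x| + enorm (x - q0)); split; first exact: num_real.
  move=> M /ltW ltM q [_ /= Kq]; apply: le_trans ltM.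
  rewrite -[q](subKr x) (le_trans (ler_normB _ _))// lerD2l.
  exact: le_trans (mx_norm_le_enorm _) Kq.
have K0 : K !=set0 by exists q0; split => /=.
have [|p /set_mem [Cp _] pmin] := @EVT_min_rV R n (fun q => enorm (x - q)) K K0
    (bounded_closed_compact Kb Kcl).
  by apply: continuous_subspaceT => q; exact: enorm_distC_continuous.
exists p; split => // q Cq.
have [Kq|/ltW Kq] := leP (enorm (x - q)) (enorm (x - q0)).
  by apply: pmin; apply/mem_set; split.
by apply: le_trans Kq; apply: pmin; apply/mem_set; split => /=.
Qed.

Lemma projP x : closest_point C x (proj C x).
Proof. exact: xgetPex _ (closest_point_exists x). Qed.

Lemma proj_in x : C (proj C x).
Proof. by have [] := projP x. Qed.

Lemma proj_id x : C x -> proj C x = x.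
Proof.
move=> Cx; have [_ /(_ x Cx)] := projP x.
rewrite enorm_le subrr => le0; apply/eqP; rewrite eq_sym -subr_eq0; apply/eqP.
apply: dotv_eq0; apply/eqP; rewrite eq_le dotv_ge0 andbT.
by rewrite (le_trans le0)// dotv0r.
Qed.

Lemma midpoint_refl x : 2^-1 *: (x + refl C x) = proj C x.
Proof. by rewrite /refl addrC subrK scalerA mulVf ?scale1r// pnatr_eq0. Qed.

Lemma refl_fix x : refl C x = x -> C x.
Proof.
move=> xx; have := proj_in x; rewrite -midpoint_refl xx.
by rewrite -mulr2n -[x *+ 2]scaler_nat scalerA mulVf ?scale1r// pnatr_eq0.
Qed.

End Projection.

(** * Reflections in closed cones *)

Section Cone.
Context {R : realType} {n : nat} {C : set 'rV[R]_n}.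
Hypotheses (C0 : C !=set0) (Ccone : closed_cone C).

Lemma cone_scale a v : 0 <= a -> C v -> C (a *: v).
Proof. by move=> a0 Cv; have [_ ->] := Ccone; exists a => //; exists v. Qed.

Lemma cone_zero : C 0.
Proof. by have [v Cv] := C0; rewrite -(scale0r v); exact: cone_scale. Qed.

(** The ray spanned by [p = P_C x] stays in [C], so [a = 1] minimises the
distance from [x] to [a *: p] over [0 <= a], and the derivative
[2 * (dotv p p - dotv x p)] of its square at [1] vanishes. *)
Lemma proj_cone_orthogonal x : dotv (proj C x) (proj C x) = dotv x (proj C x).
Proof.
have [Cp pmin] := projP C0 Ccone.1 x; set p := proj C x in Cp pmin *.
have ray a : 0 <= a -> 0 <= (a - 1) * ((a + 1) * dotv p p - 2 * dotv x p).
  move=> a0; have := pmin _ (cone_scale a0 Cp).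
  rewrite enorm_le !dotvE (dotvC p x) -subr_ge0 => /le_trans; apply.
  by rewrite le_eqVlt; apply/orP; left; apply/eqP; ring.
have := dotv_ge0 p; rewrite le_eqVlt => /orP[/eqP/esym p0|p_gt0].
  by rewrite p0 (dotv_eq0 p0) dotv0r.
have x_ge0 : 0 <= dotv x p by have := ray 0 (lexx _); lra.
(* The minimiser of the squared distance over the whole line is [s / q], which
   is nonnegative. *)
set q := dotv p p in ray p_gt0 *; set s := dotv x p in ray x_ge0 *.
have := ray (s / q) (divr_ge0 x_ge0 (ltW p_gt0)).
have -> : (s / q - 1) * ((s / q + 1) * q - 2 * s) = - ((s - q) ^+ 2 / q).
  by field; rewrite gt_eqF.
rewrite oppr_ge0 pmulr_lle0 ?invr_gt0// => le0.
apply/eqP; rewrite eq_sym -subr_eq0 -sqrf_eq0.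
by rewrite eq_le le0 sqr_ge0.
Qed.

Lemma refl_cone_isometry x : dotv (refl C x) (refl C x) = dotv x x.
Proof.
rewrite /refl !dotvE (dotvC (proj C x) x) proj_cone_orthogonal; ring.
Qed.

End Cone.

(** * Circumcenters *)

Section Circumcenter.
Context {R : realType} {n : nat}.
Implicit Types (x y z c : 'rV[R]_n).

Lemma equidistant_dotv x y c :
  enorm (c - x) = enorm (c - y) -> 2 * dotv c (y - x) = dotv y y - dotv x x.
Proof.
by move=> /enorm_eq; rewrite !dotvE (dotvC x c) (dotvC y c); lra.
Qed.

(** The difference of two circumcenters lies in the span of [y - x] and [z - x],
and it is orthogonal to both by [equidistant_dotv], hence to itself. *)
Lemma circumcenterP x y z c : is_circumcenter x y z c -> circumcenter x y z = c.
Proof.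
move=> hc; apply: xget_unique => // c' /=.
have dir d : is_circumcenter x y z d ->
  [/\ 2 * dotv d (y - x) = dotv y y - dotv x x,
      2 * dotv d (z - x) = dotv z z - dotv x x &
      exists b e, d = x + b *: (y - x) + e *: (z - x)].
  move=> [[a [b [e [abe ->]]]] xy yz]; split.
  - exact: equidistant_dotv.
  - by apply: equidistant_dotv; rewrite xy.
  - exists b, e; apply/rowP => i; rewrite !mxE.
    by move: abe => /(canRL (addrK _)) /(canRL (addrK _)) ->; ring.
have [y1 z1 [b1 [e1 d1]]] := dir _ hc.
move=> /dir[y2 z2 [b2 [e2 d2]]].
apply/eqP; rewrite -subr_eq0; apply/eqP/dotv_eq0.
have {2}-> : c' - c = (b2 - b1) *: (y - x) + (e2 - e1) *: (z - x).
  by rewrite d1 d2; apply/rowP => i; rewrite !mxE; ring.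
rewrite dotvDr !dotvZr.
have -> : dotv (c' - c) (y - x) = 0 by rewrite dotvDl dotvNl; lra.
have -> : dotv (c' - c) (z - x) = 0 by rewrite dotvDl dotvNl; lra.
by rewrite !mulr0 addr0.
Qed.

Lemma enorm_midpoint x y :
  enorm (2^-1 *: (x + y) - x) = enorm (2^-1 *: (x + y) - y).
Proof. by apply/enorm_eq; rewrite !dotvE (dotvC y x); field. Qed.

Lemma circumcenter_xxz x z : circumcenter x x z = 2^-1 *: (x + z).
Proof.
apply: circumcenterP; split => //; last exact: enorm_midpoint.
exists 2^-1, 0, 2^-1; split; first by field.
by rewrite scale0r addr0 scalerDr.
Qed.

Lemma circumcenter_xyy x y : circumcenter x y y = 2^-1 *: (x + y).
Proof.
apply: circumcenterP; split => //; last exact: enorm_midpoint.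
exists 2^-1, 2^-1, 0; split; first by field.
by rewrite scale0r addr0 scalerDr.
Qed.

Lemma circumcenter_xyx x y : circumcenter x y x = 2^-1 *: (x + y).
Proof.
apply: circumcenterP; split; rewrite ?enorm_midpoint//.
exists 2^-1, 2^-1, 0; split; first by field.
by rewrite scale0r addr0 scalerDr.
Qed.

End Circumcenter.

(** A line meets a circle in at most two points. Let [u = y - x] and
[v = z - x]. Equality of norms says [dotv u u = - (2 * dotv x u)], and likewise
for [v]. If [u] and [v] are parallel, then [dotv u u *: v = dotv u v *: u];
pairing with [x] gives [dotv v v = dotv u v], and by symmetry
[dotv u u = dotv u v], so that [z - y = v - u] has norm zero. *)
Lemma concyclic_noncollinear (F : idomainType) (x0 x1 y0 y1 z0 z1 : F) :
  x0 * x0 + x1 * x1 = y0 * y0 + y1 * y1 ->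
  x0 * x0 + x1 * x1 = z0 * z0 + z1 * z1 ->
  (y0 - x0) * (y0 - x0) + (y1 - x1) * (y1 - x1) != 0 ->
  (z0 - x0) * (z0 - x0) + (z1 - x1) * (z1 - x1) != 0 ->
  (z0 - y0) * (z0 - y0) + (z1 - y1) * (z1 - y1) != 0 ->
  (y0 - x0) * (z1 - x1) - (y1 - x1) * (z0 - x0) != 0.
Proof.
move=> nxy nxz u_neq0 v_neq0; apply: contra_neq => flat.
pose p := (y0 - x0) * (z0 - x0) + (y1 - x1) * (z1 - x1).
have pv : p = (z0 - x0) * (z0 - x0) + (z1 - x1) * (z1 - x1).
  (* The last summand is the inner product of [x] with the vector
     [dotv u u *: v - dotv u v *: u], a multiple of the signed area; the other
     two come from replacing [dotv x u] and [dotv x v]. *)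
  apply: (mulfI u_neq0); apply/eqP; rewrite -subr_eq0; apply/eqP.
  transitivity (p * (y0 * y0 + y1 * y1 - (x0 * x0 + x1 * x1))
    - ((y0 - x0) * (y0 - x0) + (y1 - x1) * (y1 - x1))
      * (z0 * z0 + z1 * z1 - (x0 * x0 + x1 * x1))
    + 2 * ((y0 - x0) * (z1 - x1) - (y1 - x1) * (z0 - x0))
      * (x1 * (y0 - x0) - x0 * (y1 - x1))); first by rewrite /p; ring.
  by rewrite flat -nxy -nxz !subrr !mulr0 !mul0r subrr addr0.
have pu : p = (y0 - x0) * (y0 - x0) + (y1 - x1) * (y1 - x1).
  apply: (mulfI v_neq0); apply/eqP; rewrite -subr_eq0; apply/eqP.
  transitivity (p * (z0 * z0 + z1 * z1 - (x0 * x0 + x1 * x1))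
    - ((z0 - x0) * (z0 - x0) + (z1 - x1) * (z1 - x1))
      * (y0 * y0 + y1 * y1 - (x0 * x0 + x1 * x1))
    - 2 * ((y0 - x0) * (z1 - x1) - (y1 - x1) * (z0 - x0))
      * (x1 * (z0 - x0) - x0 * (z1 - x1))); first by rewrite /p; ring.
  by rewrite flat -nxy -nxz !subrr !mulr0 !mul0r !subrr.
transitivity ((y0 - x0) * (y0 - x0) + (y1 - x1) * (y1 - x1)
  + ((z0 - x0) * (z0 - x0) + (z1 - x1) * (z1 - x1)) - 2 * p).
  by rewrite /p; ring.
by rewrite -pu -pv; ring.
Qed.

Lemma dotv2E (R : realType) (u v : 'rV[R]_2) :
  dotv u v = u ord0 0 * v ord0 0 + u ord0 1 * v ord0 1.
Proof.
rewrite /dotv !big_ord_recl big_ord0 addr0.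
by rewrite (_ : lift ord0 ord0 = 1)//; exact/val_inj.
Qed.

(** The origin is equidistant from the three points in any dimension; it lies in
their affine hull because three non-collinear points span the plane. *)
Lemma circumcenter_circle (R : realType) (x y z : 'rV[R]_2) :
  dotv x x = dotv y y -> dotv x x = dotv z z ->
  x != y -> x != z -> y != z -> circumcenter x y z = 0.
Proof.
move=> nxy nxz xy xz yz; apply: circumcenterP; split; last 2 first.
- by rewrite !sub0r; apply/enorm_eq; rewrite !dotvE !opprK.
- by rewrite !sub0r; apply/enorm_eq; rewrite !dotvE !opprK -nxy.
have chord (u v : 'rV[R]_2) : u != v -> dotv (v - u) (v - u) != 0.
  by apply: contra_neq => /dotv_eq0 /eqP; rewrite subr_eq0 => /eqP.
have area : (y ord0 0 - x ord0 0) * (z ord0 1 - x ord0 1)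
    - (y ord0 1 - x ord0 1) * (z ord0 0 - x ord0 0) != 0.
  move: (chord _ _ xy) (chord _ _ xz) (chord _ _ yz) nxy nxz.
  rewrite !dotv2E !mxE => u0 v0 w0 nxy nxz.
  exact: concyclic_noncollinear.
(* The barycentric coordinates of the origin are ratios of signed areas
   (Cramer's rule). *)
set D := _ - _ in area.
exists ((y ord0 0 * z ord0 1 - y ord0 1 * z ord0 0) / D),
  ((z ord0 0 * x ord0 1 - z ord0 1 * x ord0 0) / D),
  ((x ord0 0 * y ord0 1 - x ord0 1 * y ord0 0) / D); split.
  by rewrite -!mulrDl; apply: canLR (mulfK area) _; rewrite /D; ring.
apply/rowP => -[[|[|//]] i2]; rewrite !mxE !(mulrAC _ D^-1) -!mulrDl.
- rewrite (_ : Ordinal i2 = 0); last exact/val_inj.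
  by apply/esym/(canLR (mulfK area)); ring.
- rewrite (_ : Ordinal i2 = 1); last exact/val_inj.
  by apply/esym/(canLR (mulfK area)); ring.
Qed.

(** * One step of the circumcentered-reflection method *)

Lemma convex_midpoint (R : realType) (n : nat) (C : set 'rV[R]_n) u v :
  convex_set C -> C u -> C v -> C (2^-1 *: (u + v)).
Proof.
move=> Ccvx Cu Cv.
have half_ge0 : 0 <= 2^-1 :> R by lra.
have half_le1 : 2^-1 <= 1 :> R by lra.
have /set_mem := Ccvx u v (Itv01 half_ge0 half_le1) (mem_set Cu) (mem_set Cv).
rewrite scalerDr [X in _ -> C (_ + X)](_ : _ = (1 - 2^-1) *: v)//.
by congr (_ *: _); field.
Qed.

Section Method.
Context {R : realType} {A B : set 'rV[R]_2}.
Hypotheses (A0 : A !=set0) (B0 : B !=set0).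
Hypotheses (Acone : closed_cone A) (Bcone : closed_cone B).
Hypothesis (Bconv : convex_set B).

Lemma CRM_proj z : A z -> CRM A B z = proj B z.
Proof.
move=> Az; have yz : refl A z = z.
  by rewrite /refl (proj_id A0 Acone.1 Az) -[2]/(1 + 1) scalerDl scale1r addrK.
by rewrite /CRM yz circumcenter_xxz midpoint_refl.
Qed.

(** The second conclusion is what makes the method stop: a step starting in [B]
stays in [B], although it is taken towards [A]. *)
Lemma CRM_outside z : ~ A z -> A (CRM A B z) /\ (B z -> B (CRM A B z)).
Proof.
move=> nAz; have [AP BP] := (proj_in A0 Acone.1, proj_in B0 Bcone.1).
rewrite /CRM; set y := refl A z; set w := refl B y.
have zy : z != y by apply/eqP => e; apply: nAz; exact: (refl_fix A0 Acone.1).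
have mid : 2^-1 *: (z + y) = proj A z by exact: midpoint_refl.
have [wy|yw] := eqVneq y w.
  rewrite -wy circumcenter_xyy; split=> [|Bz]; first by rewrite mid.
  by apply: convex_midpoint => //; apply: (refl_fix B0 Bcone.1).
have [wz|zw] := eqVneq z w.
  rewrite -wz circumcenter_xyx; split=> [|_]; first by rewrite mid.
  by rewrite addrC wz midpoint_refl.
have nzy : dotv z z = dotv y y by rewrite (refl_cone_isometry A0 Acone).
have nzw : dotv z z = dotv w w by rewrite (refl_cone_isometry B0 Bcone).
rewrite (circumcenter_circle nzy nzw zy zw yw).
by split=> [|_]; exact: cone_zero.
Qed.

Lemma CRM_in_union z : A (CRM A B z) \/ B (CRM A B z).
Proof.
have [Az|/CRM_outside[]] := pselect (A z); last by left.
by right; rewrite CRM_proj//; exact: proj_in B0 Bcone.1 z.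
Qed.

Lemma CRM_feasible z : B z -> (A `&` B) (CRM A B z).
Proof.
move=> Bz; have [Az|/CRM_outside[AC BC]] := pselect (A z); last by split; auto.
by rewrite CRM_proj// (proj_id B0 Bcone.1 Bz).
Qed.

End Method.

Theorem theorem6 (R : realType) (A B : set 'rV[R]_2)
    (A0 : A !=set0) (B0 : B !=set0)
    (Acone : closed_cone A) (Bcone : closed_cone B)
    (Aconv : convex_set A) (Bconv : convex_set B) (x : 'rV[R]_2) :
  exists k : nat, (k <= 3)%N /\ (A `&` B) (iter k (CRM A B) x).
Proof.
have [Ax|Bx] := CRM_in_union A0 B0 Acone Bcone Bconv x.
  exists 3; split => //; apply: CRM_feasible => //.
  by rewrite /= CRM_proj//; exact: proj_in B0 Bcone.1 _.
by exists 2; split => //; exact: CRM_feasible.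
Qed.
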